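(* Let $P(\alpha,\beta)=\sum_{i=0}^k\alpha^i\beta^{k-i}B_i$, $B_i\in\mathbb{C}^{n\times n}$, be a regular matrix polynomial of grade $k$, let $(\alpha_0,\beta_0)\neq(0,0)$ be a simple eigenvalue of $P(\alpha,\beta)$, and let $\lambda_0:=\alpha_0/\beta_0$, where $\lambda_0=\infty$ if $\beta_0=0$. Assume that the same weights $\omega_i$ are used in the definition of all the condition numbers below, i.e. $\|\Delta B_i\|_2\le\epsilon\,\omega_i$, $i=0,\dots,k$, in all of them. Then: (i) if $\beta_0\neq0$, $$\kappa_\theta((\alpha_0,\beta_0),P)=\kappa_a(\lambda_0,P)\,\frac{1}{1+|\lambda_0|^2};$$ (ii) if $\alpha_0\neq0$, $$\kappa_\theta((\alpha_0,\beta_0),P)=\kappa_a\!\left(\frac1{\lambda_0},\operatorname{rev}P\right)\frac{1}{1+\left|\frac1{\lambda_0}\right|^2};$$ (iii) if $\alpha_0\neq0$ and $\beta_0\neq0$, $$\kappa_\theta((\alpha_0,\beta_0),P)=\kappa_r(\lambda_0,P)\,\frac{|\lambda_0|}{1+|\lambda_0|^2}.$$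
   Context: The homogeneous polynomial $P(\alpha,\beta)=\sum_{i=0}^k\alpha^i\beta^{k-i}B_i$ corresponds to the non-homogeneous $P(\lambda)=\sum_{i=0}^k\lambda^iB_i$. Regular means the determinant is not identically zero. The reversal is $\operatorname{rev}P(\lambda)=\lambda^kP(1/\lambda)=\sum_{i=0}^k\lambda^{k-i}B_i$. An eigenvalue of $P(\alpha,\beta)$ is a line through the origin in $\mathbb{C}^2$ consisting of solutions of $\det P(\alpha,\beta)=0$, denoted $(\alpha_0,\beta_0)$ via a representative; it is simple if it is a zero of multiplicity one of $\det P(\alpha,\beta)$. It corresponds to the eigenvalue $\lambda_0=\alpha_0/\beta_0$ of $P(\lambda)$ ($\lambda_0=\infty$ if $\beta_0=0$, meaning that $0$ is an eigenvalue of $\operatorname{rev}P$). If $\lambda_0=\infty$, then $1/\lambda_0:=0$. $\|\cdot\|_2$ is the Euclidean norm on vectors and the spectral norm on matrices. $\omega_0,\dots,\omega_k\ge0$ are given weights. Non-homogeneous condition numbers: for a simple finite eigenvalue $\lambda_0$ of $P(\lambda)$ with right eigenvector $x$, $$\kappa_a(\lambda_0,P)=\lim_{\epsilon\to0}\sup\Big\{\frac{|\Delta\lambda_0|}{\epsilon}:[P(\lambda_0+\Delta\lambda_0)+\Delta P(\lambda_0+\Delta\lambda_0)](x+\Delta x)=0,\ \|\Delta B_i\|_2\le\epsilon\,\omega_i,\ i=0,\dots,k\Big\},$$ with $\Delta P(\lambda)=\sum_{i=0}^k\lambda^i\Delta B_i$, where $\lambda_0+\Delta\lambda_0$ is the unique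 simple eigenvalue of $P+\Delta P$ that approaches $\lambda_0$ as $\Delta P\to0$ and $x+\Delta x$ is an associated right eigenvector. For $\lambda_0\neq0$, $\kappa_r(\lambda_0,P)$ is defined in the same way with $|\Delta\lambda_0|/(\epsilon|\lambda_0|)$ in place of $|\Delta\lambda_0|/\epsilon$. For $\operatorname{rev}P$, the perturbation $\Delta B_i$ of the coefficient $B_i$ (which multiplies $\lambda^{k-i}$) is measured with the weight $\omega_i$. Chordal distance: for lines $\langle x\rangle,\langle y\rangle$ through the origin in $\mathbb{C}^2$, $\theta(\langle x\rangle,\langle y\rangle)=\arccos\frac{|y^*x|}{\|x\|_2\|y\|_2}\in[0,\pi/2]$ and $\chi(\langle x\rangle,\langle y\rangle)=\sin\theta(\langle x\rangle,\langle y\rangle)$. Stewart–Sun condition number: $$\kappa_\theta((\alpha_0,\beta_0),P)=\lim_{\epsilon\to0}\sup\Big\{\frac{\chi((\alpha_0,\beta_0),(\alpha_0+\Delta\alpha_0,\beta_0+\Delta\beta_0))}{\epsilon}: [P+\Delta P](\alpha_0+\Delta\alpha_0,\beta_0+\Delta\beta_0)(x+\Delta x)=0,\ \|\Delta B_i\|_2\le\epsilon\,\omega_i,\ i=0,\dots,k\Big\},$$ where $\Delta P(\alpha,\beta)=\sum_{i=0}^k\alpha^i\beta^{k-i}\Delta B_i$, $x$ is a right eigenvector of $P$ for $(\alpha_0,\beta_0)$, $x+\Delta x$ is an associated right eigenvector of $P+\Delta P$, and $(\alpha_0+\Delta\alpha_0,\beta_0+\Delta\beta_0)$ is the unique simple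 eigenvalue of $P+\Delta P$ that approaches $(\alpha_0,\beta_0)$ as $\Delta P\to0$. *)

(* Defs.v *)
From HB Require Import structures.
From mathcomp Require Import all_boot all_order all_algebra.
From mathcomp Require Import polyXY complex.
From mathcomp Require Import all_classical all_reals all_analysis.

Set Implicit Arguments.
Unset Strict Implicit.
Unset Printing Implicit Defensive.

Import Order.TTheory GRing.Theory Num.Theory.
Import numFieldNormedType.Exports.

Local Open Scope classical_set_scope.
Local Open Scope ring_scope.

Notation cmod := ComplexField.Normc.normc.

Section Norms.
Variable R : realType.
Local Notation C := R[i].

Definition enorm n (v : 'cV[C]_n) : R :=
  Num.sqrt (\sum_(i < n) cmod (v i 0) ^+ 2).

Definition specnorm n (M : 'M[C]_n) : R :=
  sup [set enorm (M *m v) | v in [set v | enorm v <= 1]].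

(* A line through the origin of C^2 is given by a nonzero representative. *)
Definition enorm2 (p : C * C) : R := Num.sqrt (cmod p.1 ^+ 2 + cmod p.2 ^+ 2).

Definition angle (p q : C * C) : R :=
  acos (cmod (q.1^* * p.1 + q.2^* * p.2) / (enorm2 p * enorm2 q)).

Definition chordal (p q : C * C) : R := sin (angle p q).

End Norms.

(* A matrix polynomial of grade k is the family of its k + 1 coefficients, *)
(* which may include a zero leading coefficient.                           *)
Section MatrixPolynomials.
Variables (R : realType) (n k : nat).
Local Notation C := R[i].
Local Notation mpol := ('I_k.+1 -> 'M[C]_n).
Implicit Types (B D : mpol) (w : 'I_k.+1 -> R).

Definition madd B D : mpol := fun i => B i + D i.

Definition mrev B : mpol := fun i => B (rev_ord i).

Definition peval B (l : C) : 'M[C]_n := \sum_(i < k.+1) l ^+ i *: B i.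

Definition heval B (p : C * C) : 'M[C]_n :=
  \sum_(i < k.+1) (p.1 ^+ i * p.2 ^+ (k - i)) *: B i.

Definition pdet B : {poly C} :=
  \det (\sum_(i < k.+1) 'X^i *: map_mx polyC (B i)).

(* Bivariate polynomials: 'X is alpha and 'Y is beta. *)
Definition hdet B : {poly {poly C}} :=
  \det (\sum_(i < k.+1)
          ('X^i * 'Y ^+ (k - i)) *: map_mx (fun c => c%:P%:P) (B i)).

Definition regular B : Prop := hdet B != 0.

Definition line_mult (f : {poly {poly C}}) (p : C * C) (m : nat) : Prop :=
  exists2 q : {poly {poly C}},
    f = (p.2%:P%:P * 'X - p.1%:P%:P * 'Y) ^+ m * q & q.[p.1, p.2] != 0.

Definition simple_heig B (p : C * C) : Prop :=
  p != (0, 0) /\ line_mult (hdet B) p 1.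

Definition simple_eig B (l : C) : Prop := mup l (pdet B) = 1%N.

Definition pert_le D w (e : R) : Prop := forall i, specnorm (D i) <= e * w i.

(* L maps a perturbation D to the eigenvalue of B + D that approaches the  *)
(* given one as D tends to 0; only its germ at D = 0 is determined.        *)
Definition eig_branch B (l0 : C) (L : mpol -> C) : Prop :=
  (exists2 d : R, 0 < d &
     forall D, pert_le D (fun=> 1) d -> simple_eig (madd B D) (L D)) /\
  (forall e : R, 0 < e -> exists2 d : R, 0 < d &
     forall D, pert_le D (fun=> 1) d -> cmod (L D - l0) < e).

Definition heig_branch B (p0 : C * C) (L : mpol -> C * C) : Prop :=
  (exists2 d : R, 0 < d &
     forall D, pert_le D (fun=> 1) d -> simple_heig (madd B D) (L D)) /\
  (forall e : R, 0 < e -> exists2 d : R, 0 < d &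
     forall D, pert_le D (fun=> 1) d -> chordal p0 (L D) < e).

Definition eig_shifts B w (l0 : C) (x : 'cV[C]_n) (L : mpol -> C) (e : R) :
    set C :=
  [set dl | exists D dx,
    [/\ pert_le D w e, l0 + dl = L D, x + dx != 0 &
        (peval B (l0 + dl) + peval D (l0 + dl)) *m (x + dx) = 0]].

Definition heig_shifts B w (p0 : C * C) (x : 'cV[C]_n)
    (L : mpol -> C * C) (e : R) : set (C * C) :=
  [set dp | exists D dx,
    [/\ pert_le D w e, p0 + dp = L D, x + dx != 0 &
        heval (madd B D) (p0 + dp) *m (x + dx) = 0]].

(* The condition numbers are given as relations, K being the value: the    *)
(* branch exists, and the limit exists and equals K for every choice of the *)
(* right eigenvector x and of the branch L.                                 *)
Definition is_kappa_a B w (l0 : C) (K : R) : Prop :=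
  (exists L, eig_branch B l0 L) /\
  forall x L, x != 0 -> peval B l0 *m x = 0 -> eig_branch B l0 L ->
    ereal_sup [set (cmod dl / e)%:E | dl in eig_shifts B w l0 x L e]
      @[e --> 0^'+] --> K%:E.

Definition is_kappa_r B w (l0 : C) (K : R) : Prop :=
  (exists L, eig_branch B l0 L) /\
  forall x L, x != 0 -> peval B l0 *m x = 0 -> eig_branch B l0 L ->
    ereal_sup [set (cmod dl / (e * cmod l0))%:E | dl in eig_shifts B w l0 x L e]
      @[e --> 0^'+] --> K%:E.

Definition is_kappa_theta B w (p0 : C * C) (K : R) : Prop :=
  (exists L, heig_branch B p0 L) /\
  forall x L, x != 0 -> heval B p0 *m x = 0 -> heig_branch B p0 L ->
    ereal_sup [set (chordal p0 (p0 + dp) / e)%:E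
              | dp in heig_shifts B w p0 x L e]
      @[e --> 0^'+] --> K%:E.

End MatrixPolynomials.

(* Main.v *)
(* Write f_D(l) for the determinant of (B + D)(l).  At a simple eigenvalue  *)
(* l0 it expands as                                                         *)
(*   f_D(l0 + h) = tau(D) + g h + O((|D| + |h|)^2),                         *)
(* with tau linear and g = f_0'(l0) != 0, so any continuous branch L of     *)
(* eigenvalues satisfies |L(D) - l0| = |tau(D)| / |g| + O(|D|^2).  Hence    *)
(* kappa_a is the supremum of |tau(D)| / |g| over the perturbations with    *)
(* |D_i| <= w_i, and no eigenvector formula is needed.  The chordal         *)
(* distance between (l0, 1) and (l, 1) is                                   *)
(*   |l - l0| / (sqrt (1 + |l0|^2) sqrt (1 + |l|^2)),                       *)
(* and l tends to l0, which gives the factor 1 / (1 + |l0|^2) in (i).       *)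
(* Exchanging alpha and beta turns P into rev P and reduces (ii) to (i).    *)
(* A branch exists because the distance from l0 to the nearest root of f_D  *)
(* is at most deg(f_D) |f_D(l0) / f_D'(l0)|.                                *)
From HB Require Import structures.
Require Import Defs.
From mathcomp Require Import all_boot all_order all_algebra.
From mathcomp Require Import polyXY complex.
From mathcomp Require Import all_classical all_reals all_analysis.
From mathcomp Require Import ring lra.
Import Order.TTheory GRing.Theory Num.Theory.
Import numFieldNormedType.Exports.

Set Implicit Arguments.
Unset Strict Implicit.
Unset Printing Implicit Defensive.

Local Open Scope ring_scope.

(** * Norms and perturbations *)

(** The core is that a simple eigenvalue moves with a first-order speed, uniformly in the direction
    of the perturbation. [smooth_pdet] supplies the expansion of the determinant, assembled through
    sums and products from exact expansions of constants, the variable and the entries;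
    [eig_speed_exists] solves it for the displacement of the root, and [eig_branch_exists] gets a
    branch from [near_root].

    A perturbation of weighted size e is e times one from the fixed set [pert_le D w 1]. On this set
    the quotients in the three condition numbers converge uniformly to a multiple of the speed, and
    [cvg_ereal_sup] passes to the suprema. The multiple is 1 for kappa_a, 1 / |l0| for kappa_r and 1
    / (1 + |l0|^2) for kappa_theta, so the formulas compare multiples of one number, [max_speed].

    Lines and ratios are linked by [simple_heig_simple_eig] and [heig_branch_ratio] when beta is
    nonzero. [is_kappa_theta_rev] gives access to the other chart, and [is_kappa_theta_unique] makes
    the two charts agree. *)

Section Modulus.
Variable R : realType.
Local Notation C := R[i].
Implicit Types (x y z : C) (r : R).

Lemma cmodE x : `|x| = (cmod x)%:C%C. Proof. by []. Qed.

Lemma cmod0 : cmod (0 : C) = 0. Proof. exact: ComplexField.Normc.normc0. Qed.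

Lemma cmodM x y : cmod (x * y) = cmod x * cmod y.
Proof. exact: ComplexField.Normc.normcM. Qed.

Lemma cmodN x : cmod (- x) = cmod x. Proof. exact: normcN. Qed.

Lemma cmodB x y : cmod (x - y) = cmod (y - x).
Proof. by rewrite -cmodN opprB. Qed.

Lemma cmodD x y : cmod (x + y) <= cmod x + cmod y.
Proof. exact: le_normcD. Qed.

Lemma cmod_ge0 x : 0 <= cmod x.
Proof. by case: x => a b; exact: sqrtr_ge0. Qed.

Lemma cmod_eq0 x : (cmod x == 0) = (x == 0).
Proof.
by apply/eqP/eqP => [/ComplexField.Normc.eq0_normc //|->]; exact: cmod0.
Qed.

Lemma cmod_gt0 x : (0 < cmod x) = (x != 0).
Proof. by rewrite lt_def cmod_ge0 andbT cmod_eq0. Qed.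

Lemma cmod_real r : cmod r%:C%C = `|r|.
Proof. by rewrite /= expr0n addr0 sqrtr_sqr. Qed.

Lemma cmod_sqr x : (cmod x ^+ 2)%:C%C = x * x^*.
Proof. by rewrite -normCK cmodE -rmorphXn. Qed.

Lemma cmod_sum (I : Type) (s : seq I) (P : pred I) (F : I -> C) :
  cmod (\sum_(i <- s | P i) F i) <= \sum_(i <- s | P i) cmod (F i).
Proof.
elim/big_rec2: _ => [|i y1 y2 _ le12]; first by rewrite cmod0.
by apply: le_trans (cmodD _ _) _; rewrite lerD2l.
Qed.

Lemma cmod_dist x y : `|cmod x - cmod y| <= cmod (x - y).
Proof.
have le z t : cmod z - cmod t <= cmod (z - t).
  by rewrite lerBlDr (le_trans _ (cmodD _ _)) // subrK.
by rewrite ler_norml le andbT lerNl opprB (cmodB x).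
Qed.

End Modulus.

Section SpectralNorm.
Variables (R : realType) (n : nat).
Local Notation C := R[i].
Implicit Types (M : 'M[C]_n) (v : 'cV[C]_n).

Lemma cmod_entry_le_enorm v i : cmod (v i 0) <= enorm v.
Proof.
rewrite /enorm -(ger0_norm (cmod_ge0 (v i 0))) -sqrtr_sqr ler_wsqrtr //.
by rewrite (bigD1 i) //= lerDl sumr_ge0 // => j _; exact: sqr_ge0.
Qed.

Lemma enormZ (r : R) v : 0 <= r -> enorm (r%:C%C *: v) = r * enorm v.
Proof.
move=> r0; rewrite /enorm -[in RHS](ger0_norm r0) -sqrtr_sqr -sqrtrM ?sqr_ge0 //.
rewrite mulr_sumr; congr Num.sqrt; apply: eq_bigr => i _.
by rewrite mxE cmodM exprMn cmod_real ger0_norm.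
Qed.

Lemma enorm0 : enorm (0 : 'cV[C]_n) = 0.
Proof. by rewrite -(scaler0 _ (0%:C%C)) enormZ // mul0r. Qed.

Lemma enorm_delta (j : 'I_n) : enorm (delta_mx j 0 : 'cV[C]_n) = 1.
Proof.
rewrite /enorm (bigD1 j) //= big1 => [|i /negPf ij].
  by rewrite mxE !eqxx addr0 cmod_real normr1 expr1n sqrtr1.
by rewrite mxE ij cmod0 expr0n.
Qed.

Lemma specnorm_has_sup M :
  has_sup [set enorm (M *m v) | v in [set v | enorm v <= 1]]%classic.
Proof.
split; first by exists (enorm (M *m 0)), 0 => //=; rewrite enorm0 ler01.
exists (Num.sqrt (\sum_i (\sum_j cmod (M i j)) ^+ 2)) => _ [v /= v1 <-].
rewrite ler_wsqrtr //; apply: ler_sum => i _.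
rewrite ler_pXn2r ?nnegrE ?cmod_ge0 //; last first.
  by apply: sumr_ge0 => j _; exact: cmod_ge0.
rewrite mxE (le_trans (cmod_sum _ _ _)) //; apply: ler_sum => j _.
rewrite cmodM ler_piMr ?cmod_ge0 //.
exact: le_trans (cmod_entry_le_enorm _ _) v1.
Qed.

Lemma enorm_mulmx_le M v : enorm v <= 1 -> enorm (M *m v) <= specnorm M.
Proof.
by move=> v1; apply: ub_le_sup; [case: (specnorm_has_sup M)|exists v].
Qed.

Lemma specnorm_ge0 M : 0 <= specnorm M.
Proof.
apply: le_trans (@enorm_mulmx_le M 0 _); first exact: sqrtr_ge0.
by rewrite enorm0 ler01.
Qed.

Lemma cmod_entry_le_specnorm M i j : cmod (M i j) <= specnorm M.
Proof.
apply: (@le_trans _ _ (cmod ((M *m (delta_mx j 0 : 'cV_n)) i 0))).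
  by rewrite -colE mxE.
apply: le_trans (cmod_entry_le_enorm _ _) _.
by apply: enorm_mulmx_le; rewrite enorm_delta.
Qed.

Lemma specnormZ_le (r : R) M : 0 <= r -> specnorm (r%:C%C *: M) <= r * specnorm M.
Proof.
move=> r0; apply: ge_sup.
  by case: (specnorm_has_sup (r%:C%C *: M)).
move=> _ [v /= v1 <-]; rewrite -scalemxAl enormZ //.
by rewrite ler_wpM2l // enorm_mulmx_le.
Qed.

Lemma specnorm0 : specnorm (0 : 'M[C]_n) = 0.
Proof.
apply/eqP; rewrite eq_le specnorm_ge0 andbT.
rewrite -[X in specnorm X](scale0r (0 : 'M[C]_n)).
by rewrite (le_trans (specnormZ_le 0 _)) // mul0r.
Qed.

End SpectralNorm.

Section Perturbations.
Variables (R : realType) (n k : nat).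
Local Notation C := R[i].
Local Notation mpol := ('I_k.+1 -> 'M[C]_n).
Implicit Types (B D : mpol) (w : 'I_k.+1 -> R) (r d e : R).

Definition mscale r D : mpol := fun i => r%:C%C *: D i.

Lemma mscaleA r s D : mscale r (mscale s D) = mscale (r * s) D.
Proof. by apply/funext => i; rewrite /mscale scalerA rmorphM. Qed.

Lemma mscale1 D : mscale 1 D = D.
Proof. by apply/funext => i; rewrite /mscale scale1r. Qed.

Lemma pert_le_ge0 D d : pert_le D (fun=> 1) d -> 0 <= d.
Proof. by move/(_ ord0); rewrite mulr1; apply: le_trans; exact: specnorm_ge0. Qed.

Lemma pert_le0 w e : (forall i, 0 <= w i) -> 0 <= e -> pert_le (fun=> 0 : 'M[C]_n) w e.
Proof. by move=> w0 e0 i; rewrite specnorm0 mulr_ge0. Qed.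

Lemma pert_leZ D w r e : 0 <= r -> pert_le D w e -> pert_le (mscale r D) w (r * e).
Proof.
move=> r0 De i; rewrite -mulrA (le_trans (specnormZ_le _ r0)) //.
by rewrite ler_wpM2l.
Qed.

(** The factor [1 + \sum_i w i] dominates every weight and stays positive when all weights vanish;
    it turns weighted bounds into the unweighted ones in which branches are stated. *)
Lemma pert_le_sum D w e : (forall i, 0 <= w i) -> 0 <= e ->
  pert_le D w e -> pert_le D (fun=> 1) (e * (1 + \sum_i w i)).
Proof.
move=> w0 e0 De i; rewrite mulr1 (le_trans (De i)) // ler_wpM2l //.
by rewrite (bigD1 i) //= addrCA lerDl addr_ge0 // sumr_ge0.
Qed.

End Perturbations.

(** * First-order expansion of the determinant *)

Section FirstOrder.
Variables (R : realType) (n k : nat) (l0 : R[i]).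
Local Notation C := R[i].
Local Notation mpol := ('I_k.+1 -> 'M[C]_n).
Local Notation mzero := (fun=> 0 : 'M[C]_n).
Implicit Types (D : mpol) (d M : R) (h : C) (phi psi : mpol -> {poly C}).

(** A bound [d] on the perturbation stands in for its norm. One constant [M] controls both the
    linear part and the quadratic remainder; real homogeneity of [tau] is what the rescaling by e
    uses. *)
Definition expansion phi (tau : mpol -> C) M : Prop :=
  [/\ 0 <= M, forall (r : R) D, tau (mscale r D) = r%:C%C * tau D,
      forall D d, pert_le D (fun=> 1) d -> d <= 1 -> cmod (tau D) <= M * d
    & forall D d h, pert_le D (fun=> 1) d -> d <= 1 -> cmod h <= 1 ->
        cmod ((phi D).[l0 + h] -
              ((phi mzero).[l0] + tau D + h * (phi mzero)^`().[l0]))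
          <= M * (d + cmod h) ^+ 2].

Definition expands phi : Prop := exists tau M, expansion phi tau M.

(** Since d + |h| <= 2, the remainder is at most 2 M (d + |h|); the linear part adds M d, and the
    derivative term adds |h| times its modulus. *)
Lemma expansion_lipschitz phi tau M D d h :
  expansion phi tau M ->
  pert_le D (fun=> 1) d -> d <= 1 -> cmod h <= 1 ->
  cmod ((phi D).[l0 + h] - (phi mzero).[l0])
    <= (3 * M + cmod (phi mzero)^`().[l0]) * (d + cmod h).
Proof.
case=> M0 _ tauP phiP Dd d1 h1.
have d0 := pert_le_ge0 Dd; have h0 := cmod_ge0 h.
have := phiP _ _ _ Dd d1 h1; have := tauP _ _ Dd d1.
set a := _.[_]; set c := _.[_]; set g := _.[_]; set t := tau D => tM rM.
have -> : a - c = a - (c + t + h * g) + t + h * g by ring.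
apply: le_trans (cmodD _ _) _; rewrite cmodM.
apply: (@le_trans _ _ (M * (d + cmod h) ^+ 2 + M * d + cmod h * cmod g)).
  by rewrite lerD2r (le_trans (cmodD _ _)) // lerD.
have g0 := cmod_ge0 g; have := mulr_ge0 M0 h0; have := mulr_ge0 M0 d0.
by have := mulr_ge0 g0 d0; nra.
Qed.

Lemma expands_polyC (c : C) : expands (fun=> c%:P).
Proof.
exists (fun=> 0), 0; split=> //.
- by move=> r D; rewrite mulr0.
- by move=> D d _ _; rewrite cmod0 mul0r.
- by move=> D d h _ _ _; rewrite derivC !hornerC mulr0 !addr0 subrr cmod0 mul0r.
Qed.

Lemma expands_polyX : expands (fun=> 'X).
Proof.
exists (fun=> 0), 0; split=> //.
- by move=> r D; rewrite mulr0.
- by move=> D d _ _; rewrite cmod0 mul0r.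
- move=> D d h _ _ _; rewrite derivX !hornerX hornerC mulr1 addr0 subrr.
  by rewrite cmod0 mul0r.
Qed.

Lemma expands_entry i a b : expands (fun D => (D i a b)%:P).
Proof.
exists (fun D => D i a b), 1; split=> //.
- by move=> r D; rewrite mxE.
- move=> D d Dd _; apply: le_trans (cmod_entry_le_specnorm _ _ _) _.
  by rewrite mulrC.
- move=> D d h _ _ _; rewrite derivC !hornerC mxE add0r mulr0 addr0 subrr.
  by rewrite cmod0 mul1r sqr_ge0.
Qed.

Lemma expandsD phi psi :
  expands phi -> expands psi -> expands (fun D => phi D + psi D).
Proof.
move=> [t [M [M0 tZ tM phiM]]] [u [N [N0 uZ uN psiN]]].
exists (fun D => t D + u D), (M + N); split; first exact: addr_ge0.
- by move=> r D; rewrite tZ uZ mulrDr.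
- move=> D d Dd d1; rewrite (le_trans (cmodD _ _)) // mulrDl.
  by rewrite lerD ?tM ?uN.
- move=> D d h Dd d1 h1; rewrite derivD !hornerD mulrDl.
  have := lerD (phiM _ _ _ Dd d1 h1) (psiN _ _ _ Dd d1 h1).
  apply: le_trans; apply: le_trans (cmodD _ _).
  by rewrite le_eqVlt; apply/orP; left; apply/eqP; congr cmod; ring.
Qed.

(** The error of a product splits as (a - c)(a' - c') + c r' + r c', where r and r' are the errors
    of the factors. The first term is quadratic by [expansion_lipschitz], the other two by
    hypothesis; this explains the three summands of the constant. *)
Lemma expandsM phi psi :
  expands phi -> expands psi -> expands (fun D => phi D * psi D).
Proof.
move=> [t [M phiE]] [u [N psiE]].
have [M0 tZ tM phiM] := phiE; have [N0 uZ uN psiN] := psiE.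
pose c := (phi mzero).[l0]; pose c' := (psi mzero).[l0].
pose g := (phi mzero)^`().[l0]; pose g' := (psi mzero)^`().[l0].
pose A := 3 * M + cmod g; pose A' := 3 * N + cmod g'.
have [c0 c'0] := (cmod_ge0 c, cmod_ge0 c').
have A0 : 0 <= A by rewrite addr_ge0 ?mulr_ge0 ?cmod_ge0.
have A'0 : 0 <= A' by rewrite addr_ge0 ?mulr_ge0 ?cmod_ge0.
exists (fun D => c * u D + t D * c'), (A * A' + cmod c * N + M * cmod c').
split.
- by rewrite !addr_ge0 ?mulr_ge0.
- by move=> r D; rewrite tZ uZ; ring.
- move=> D d Dd d1; rewrite (le_trans (cmodD _ _)) // !cmodM.
  have d0 := pert_le_ge0 Dd.
  have := ler_wpM2l c0 (uN _ _ Dd d1); have := ler_wpM2r c'0 (tM _ _ Dd d1).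
  by have := mulr_ge0 (mulr_ge0 A0 A'0) d0; nra.
- move=> D d h Dd d1 h1; rewrite derivM hornerD !hornerM -/c -/c' -/g -/g'.
  have := expansion_lipschitz phiE Dd d1 h1.
  have := expansion_lipschitz psiE Dd d1 h1.
  have := psiN _ _ _ Dd d1 h1; have := phiM _ _ _ Dd d1 h1.
  rewrite -/c -/c' -/g -/g' -/A -/A'.
  set a := (phi D).[_]; set a' := (psi D).[_]; set s := d + cmod h.
  set r := a - _ ; set r' := a' - _ => rM r'N a'A aA.
  have -> : a * a' - (c * c' + (c * u D + t D * c') + h * (g * c' + c * g'))
          = (a - c) * (a' - c') + c * r' + r * c' by rewrite /r /r'; ring.
  rewrite [leRHS]mulrDl (le_trans (cmodD _ _)) // lerD //; last first.
    by rewrite cmodM mulrAC ler_wpM2r.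
  rewrite [leRHS]mulrDl (le_trans (cmodD _ _)) // lerD //; last first.
    by rewrite cmodM -mulrA ler_wpM2l.
  by rewrite cmodM expr2 mulrACA ler_pM ?cmod_ge0.
Qed.

(* The degree bound makes near_root uniform in the perturbation. *)
Definition smooth phi : Prop :=
  [/\ expands phi, expands (fun D => (phi D)^`()) &
      exists N, forall D, (size (phi D) <= N)%N].

Lemma smooth_polyC (c : C) : smooth (fun=> c%:P).
Proof.
split; [exact: expands_polyC| |by exists 1%N => D; exact: size_polyC_leq1].
by rewrite (_ : (fun=> _) = (fun=> 0%:P)) ?derivC //; exact: expands_polyC.
Qed.

Lemma smooth_polyX : smooth (fun=> 'X).
Proof.
split; [exact: expands_polyX| |by exists 2 => D; rewrite size_polyX].
by rewrite (_ : (fun=> _) = (fun=> 1%:P)) ?derivX //; exact: expands_polyC.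
Qed.

Lemma smooth_entry i a b : smooth (fun D => (D i a b)%:P).
Proof.
split; [exact: expands_entry| |by exists 1%N => D; exact: size_polyC_leq1].
rewrite (_ : (fun D => _) = (fun=> 0%:P)); first exact: expands_polyC.
by apply/funext => D; rewrite derivC.
Qed.

Lemma smoothD phi psi :
  smooth phi -> smooth psi -> smooth (fun D => phi D + psi D).
Proof.
move=> [phi1 phi2 [N phiN]] [psi1 psi2 [P psiP]]; split.
- exact: expandsD.
- rewrite (_ : (fun D => _) = fun D => (phi D)^`() + (psi D)^`()).
    exact: expandsD.
  by apply/funext => D; rewrite derivD.
- exists (maxn N P) => D; apply: leq_trans (size_polyD _ _) _.
  by rewrite geq_max !leq_max phiN psiP orbT.
Qed.

Lemma smoothM phi psi :
  smooth phi -> smooth psi -> smooth (fun D => phi D * psi D).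
Proof.
move=> [phi1 phi2 [N phiN]] [psi1 psi2 [P psiP]]; split.
- exact: expandsM.
- rewrite (_ : (fun D => _) =
      fun D => (phi D)^`() * psi D + phi D * (psi D)^`()).
    by apply: expandsD; exact: expandsM.
  by apply/funext => D; rewrite derivM.
- exists (N + P)%N => D; apply: leq_trans (size_polyMleq _ _) _.
  by apply: leq_trans (leq_pred _) _; exact: leq_add.
Qed.

Lemma smooth_sum (I : Type) (s : seq I) (P : pred I) (F : I -> mpol -> {poly C}) :
  (forall i, smooth (F i)) -> smooth (fun D => \sum_(i <- s | P i) F i D).
Proof.
move=> smF; elim: s => [|i s IHs].
  rewrite (_ : (fun D => _) = (fun=> 0%:P)); first exact: smooth_polyC.
  by apply/funext => D; rewrite big_nil.
case Pi: (P i); last first.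
  rewrite (_ : (fun D => _) = (fun D => \sum_(i <- s | P i) F i D)) //.
  by apply/funext => D; rewrite big_cons Pi.
rewrite (_ : (fun D => _) = (fun D => F i D + \sum_(i <- s | P i) F i D)).
  exact: smoothD.
by apply/funext => D; rewrite big_cons Pi.
Qed.

Lemma smooth_prod (I : Type) (s : seq I) (F : I -> mpol -> {poly C}) :
  (forall i, smooth (F i)) -> smooth (fun D => \prod_(i <- s) F i D).
Proof.
move=> smF; elim: s => [|i s IHs].
  rewrite (_ : (fun D => _) = (fun=> 1%:P)); first exact: smooth_polyC.
  by apply/funext => D; rewrite big_nil.
rewrite (_ : (fun D => _) = (fun D => F i D * \prod_(i <- s) F i D)).
  exact: smoothM.
by apply/funext => D; rewrite big_cons.
Qed.

(** By the Leibniz formula, closure under sums and products is enough. *)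
Lemma smooth_det m (A : mpol -> 'M[{poly C}]_m) :
  (forall i j, smooth (fun D => A D i j)) -> smooth (fun D => \det (A D)).
Proof.
move=> smA; apply: smooth_sum => s; apply: smoothM.
  by rewrite -(rmorph_sign polyC); exact: smooth_polyC.
exact: smooth_prod.
Qed.

Lemma smooth_pdet (B : mpol) : smooth (fun D => pdet (madd B D)).
Proof.
apply: smooth_det => a b.
(* The power ['X^i] is spelled out as a product of [i] copies of ['X] so that [smooth_prod]
   applies. *)
rewrite (_ : (fun D => _) =
    fun D => \sum_(i < k.+1) \prod_(j < i) 'X * ((B i a b)%:P + (D i a b)%:P)).
  apply: smooth_sum => i; apply: smoothM.
    by apply: smooth_prod => _; exact: smooth_polyX.
  by apply: smoothD; [exact: smooth_polyC|exact: smooth_entry].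
apply/funext => D; rewrite summxE; apply: eq_bigr => i _.
by rewrite !mxE prodr_const card_ord rmorphD.
Qed.

End FirstOrder.

(** * Simple roots and eigenvalue branches *)

Section SimpleRoots.

(** If p = q (X - x), then p'(x) = q(x), and x is a root of multiplicity one exactly when q(x) is
    nonzero. *)
Lemma mup_eq1 (F : fieldType) (x : F) (p : {poly F}) :
  mup x p = 1%N <-> root p x /\ p^`().[x] != 0.
Proof.
have deriv_root q : (q * ('X - x%:P))^`().[x] = q.[x].
  by rewrite derivM derivXsubC mulr1 hornerD hornerM hornerXsubC subrr mulr0 add0r.
have mupX : mup x ('X - x%:P) = 1%N by rewrite -[_ - _]expr1 mup_XsubCX eqxx.
split=> [mup1|[/factor_theorem[q ->]]]; last first.
  by rewrite deriv_root => qx; rewrite mupMr.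
have p0 : p != 0.
  (* [mup] is a maximum over exponents bounded by the size, so it is 0 on the zero polynomial. *)
  apply/eqP => p0; move: mup1; rewrite p0 /mup.
  by case: [arg max_(_ > _ | _) _] => m + /= mE; rewrite mE size_poly0.
have /factor_theorem[q pE] : root p x.
  by apply/contraT => /mupNroot; rewrite mup1.
have q0 : q != 0 by apply: contra_neq p0 => q0; rewrite pE q0 mul0r.
split; first by rewrite pE rootM root_XsubC eqxx orbT.
rewrite pE deriv_root; apply/negP; rewrite -rootE -dvdp_XsubCl XsubC_dvd //.
by move: mup1; rewrite pE mupM ?polyXsubC_eq0 // mupX addn1 => -[->].
Qed.

(* The logarithmic derivative of p at x is the sum of the 1 / (x - r) over *)
(* the roots r of p.                                                       *)
Lemma deriv_prod_XsubC_le (R : realType) (x : R[i]) (s : seq R[i]) (rho : R) :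
  0 <= rho -> (forall r, r \in s -> rho <= cmod (x - r)) ->
  let p := \prod_(r <- s) ('X - r%:P) in
  cmod p^`().[x] * rho <= (size s)%:R * cmod p.[x].
Proof.
move=> rho0 /=; elim: s => [|r s IHs] far.
  by rewrite big_nil derivC horner0 cmod0 !mul0r.
rewrite big_cons derivM derivXsubC mul1r hornerD !hornerM hornerXsubC.
have /IHs {}IHs r' : r' \in s -> rho <= cmod (x - r').
  by move=> r's; rewrite far // inE r's orbT.
have {far} := far r; rewrite mem_head => /(_ isT) xr.
apply: le_trans (ler_wpM2r rho0 (cmodD _ _)) _.
rewrite !cmodM /= -natr1 [leRHS]mulrDl mul1r mulrDl addrC.
apply: lerD; last by rewrite mulrC ler_wpM2r ?cmod_ge0.
by rewrite -mulrA [leRHS]mulrCA ler_wpM2l ?cmod_ge0.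
Qed.

(** If every root were farther than [rho] = 2 N |p(x)| / |p'(x)|, [deriv_prod_XsubC_le] would force
    2 N to be at most the degree, which is at most N. The factor 2 makes the contradiction
    strict. *)
Lemma near_root (R : realType) (p : {poly R[i]}) (x : R[i]) (N : nat) :
  (size p <= N)%N -> p^`().[x] != 0 ->
  exists2 r, root p r &
    cmod (r - x) * cmod p^`().[x] <= 2 * N%:R * cmod p.[x].
Proof.
move=> pN p'x; have [px|px] := eqVneq p.[x] 0.
  by exists x; [apply/eqP|rewrite subrr cmod0 mul0r mulr_ge0 ?cmod_ge0 ?mulr_ge0].
have p0 : p != 0 by apply: contra_neq px => ->; rewrite horner0.
have p'x_gt0 : 0 < cmod p^`().[x] by rewrite cmod_gt0.
have px_gt0 : 0 < cmod p.[x] by rewrite cmod_gt0.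
have N0 : 0 < N%:R :> R by rewrite ltr0n (leq_trans _ pN) // size_poly_gt0.
have [s pE] := closed_field_poly_normal p.
have lp : lead_coef p != 0 by rewrite lead_coef_eq0.
pose rho : R := 2 * N%:R * cmod p.[x] / cmod p^`().[x].
have rho0 : 0 < rho by rewrite divr_gt0 // !mulr_gt0.
have [/hasP[r rs xr]|/hasPn far] := boolP (has (fun r => cmod (x - r) <= rho) s).
  exists r; first by rewrite pE rootZ // root_prod_XsubC.
  by rewrite cmodB -ler_pdivlMr.
have : cmod p^`().[x] * rho <= (size s)%:R * cmod p.[x].
  rewrite pE derivZ !hornerZ !cmodM -mulrA [leRHS]mulrCA ler_wpM2l ?cmod_ge0 //.
  apply: deriv_prod_XsubC_le; first exact: ltW.
  by move=> r /far; rewrite -ltNge => /ltW.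
rewrite /rho mulrCA divff ?gt_eqF // mulr1 ler_pM2r // leNgt => /negP[].
apply: (@le_lt_trans _ _ N%:R); last by rewrite ltr_pMl // ltr1n.
rewrite ler_nat (leq_trans _ pN) //.
by rewrite pE size_scale // size_prod_XsubC.
Qed.

End SimpleRoots.

(** * Existence of a branch of simple eigenvalues *)

Section Branch.
Variables (R : realType) (n k : nat).
Local Notation C := R[i].
Local Notation mpol := ('I_k.+1 -> 'M[C]_n).
Implicit Types (B D : mpol) (l : C) (d e : R).

Lemma simple_eigP B l :
  simple_eig B l <-> root (pdet B) l /\ (pdet B)^`().[l] != 0.
Proof. exact: mup_eq1. Qed.

Lemma madd0 B : madd B (fun=> 0) = B.
Proof. by apply/funext => i; rewrite /madd addr0. Qed.

Lemma pert_le_trans D w d e : (forall i, 0 <= w i) ->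
  d <= e -> pert_le D w d -> pert_le D w e.
Proof. by move=> w0 de Dd i; rewrite (le_trans (Dd i)) // ler_wpM2r. Qed.

(** A root is chosen for each perturbation by [near_root]. For small D the derivative at [l] stays
    away from 0 and the value at [l] is O(|D|), so every such choice is O(|D|)-close to [l]; the
    derivative at the chosen root is then also nonzero, which gives simplicity. *)
Lemma eig_branch_exists B l : simple_eig B l -> exists L, eig_branch B l L.
Proof.
move=> /simple_eigP[/eqP rBl derBl].
have [[t [M pE]] [u [N qE]] [S sz]] := smooth_pdet l B.
have [M0 _ _ _] := pE; have [N0 _ _ _] := qE.
have := fun D d h => expansion_lipschitz (D := D) (d := d) (h := h) pE.
have := fun D d h => expansion_lipschitz (D := D) (d := d) (h := h) qE.
rewrite !madd0 rBl; set g := (pdet B)^`().[l].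
set A := 3 * N + _; set A' := 3 * M + _ => qL pL.
have A0 : 0 <= A by rewrite addr_ge0 ?mulr_ge0 ?cmod_ge0.
have A'0 : 0 <= A' by rewrite addr_ge0 ?mulr_ge0 ?cmod_ge0.
have g0 : 0 < cmod g by rewrite cmod_gt0.
have /choice[L LP] : forall D, exists r, (pdet (madd B D))^`().[l] != 0 ->
    root (pdet (madd B D)) r /\
    cmod (r - l) * cmod (pdet (madd B D))^`().[l]
      <= 2 * S%:R * cmod (pdet (madd B D)).[l].
  move=> D; have [_|d0] := eqVneq (pdet (madd B D))^`().[l] 0; first by exists 0.
  by have [r rr rle] := near_root (sz D) d0; exists r.
have main e : 0 < e -> exists2 d, 0 < d & forall D, pert_le D (fun=> 1) d ->
    root (pdet (madd B D)) (L D) /\ cmod (L D - l) < e.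
  move=> e0.
  pose K := 4 * S%:R * A'.
  have K0 : 0 <= K by rewrite !mulr_ge0.
  (* The second bound keeps the derivative at [l] above |g| / 2; the third makes K d smaller than
     |g| e, where |L D - l| |g| <= K d. Each [+ 1] avoids a zero denominator. *)
  pose d := Num.min 1 (Num.min (cmod g / (2 * (A + 1))) (cmod g * e / (K + 1) / 2)).
  have d0 : 0 < d by rewrite !lt_min ltr01 !divr_gt0 ?mulr_gt0 ?ltr_wpDl.
  exists d => // D Dd.
  have dA : 2 * (A + 1) * d <= cmod g.
    rewrite mulrC -ler_pdivlMr ?mulr_gt0 ?ltr_wpDl //.
    by rewrite /d !ge_min lexx orbT.
  have dK : d * 2 * (K + 1) <= cmod g * e.
    rewrite -ler_pdivlMr ?mulr_gt0 ?ltr_wpDl // -ler_pdivlMr //.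
    by rewrite /d !ge_min lexx !orbT.
  have d1 : d <= 1 by rewrite /d ge_min lexx.
  have := qL D d 0 Dd d1; have := pL D d 0 Dd d1.
  rewrite cmod0 !addr0 subr0 => /(_ ler01) pl /(_ ler01) ql.
  have gl : cmod g / 2 <= cmod (pdet (madd B D))^`().[l].
    have := cmodD g ((pdet (madd B D))^`().[l] - g).
    have := cmod_dist g ((pdet (madd B D))^`().[l]).
    rewrite (cmodB g) => /(le_trans _) => /(_ _ (ler_norm _)).
    by nra.
  have /LP[-> Ll] : (pdet (madd B D))^`().[l] != 0.
    by rewrite -cmod_gt0 (lt_le_trans _ gl) // divr_gt0.
  split=> //.
  have h0 := cmod_ge0 (L D - l).
  have : cmod (L D - l) * (cmod g / 2) <= 2 * S%:R * (A' * d).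
    apply: le_trans (ler_wpM2l h0 gl) (le_trans Ll _).
    by rewrite ler_wpM2l // mulr_ge0.
  rewrite -(ltr_pM2r g0) (mulrC e) => Lg; apply: lt_le_trans dK.
  by rewrite /K; nra.
exists L; split; last first.
  by move=> e /main[d d0 dP]; exists d => // D /dP[].
(* With both the perturbation and the displacement bounded by [e], the derivative changes by at most
   2 A e, which is less than |g|. *)
pose e := Num.min 1 (cmod g / (2 * (A + 1))).
have e0 : 0 < e by rewrite lt_min ltr01 divr_gt0 // mulr_gt0 // ltr_wpDl.
have [d d0 dP] := main e e0.
exists (Num.min d e); first by rewrite lt_min d0 e0.
move=> D DP; have /dP[rL Le] : pert_le D (fun=> 1) d.
  by apply: pert_le_trans DP => //; rewrite ge_min lexx.
apply/simple_eigP; split=> //.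
have De : pert_le D (fun=> 1) e.
  by apply: pert_le_trans DP => //; rewrite ge_min lexx orbT.
have e1 : e <= 1 by rewrite /e ge_min lexx.
have := qL D e (L D - l) De e1 (le_trans (ltW Le) e1).
rewrite (addrC l) subrK => gL; rewrite -cmod_gt0.
have eA : 2 * (A + 1) * e <= cmod g.
  rewrite mulrC -ler_pdivlMr ?mulr_gt0 ?ltr_wpDl //.
  by rewrite /e !ge_min lexx orbT.
have := cmod_dist g ((pdet (madd B D))^`().[L D]).
rewrite (cmodB g) => /(le_trans _) => /(_ _ (ler_norm _)).
by nra.
Qed.

End Branch.

(** * Homogeneous and non-homogeneous eigenvalues *)

Section Dehomogenization.
Variable F : comNzRingType.

(** Substitutes (b X, b) for (alpha, beta). Scaling both arguments by b sends the point X = a / b to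
    the given representative (a, b), so cofactors are evaluated there without rescaling. *)
Definition dehom (b : F) : {poly {poly F}} -> {poly F} :=
  comp_poly (b *: 'X) \o map_poly (horner_eval b).

HB.instance Definition _ (b : F) := GRing.RMorphism.on (dehom b).

Lemma dehomX b : dehom b 'X = b *: 'X.
Proof. by rewrite /dehom /= map_polyX comp_polyX. Qed.

Lemma dehomC b c : dehom b c%:P = c.[b]%:P.
Proof. by rewrite /dehom /= map_polyC comp_polyC. Qed.

Lemma horner_dehom b f x : (dehom b f).[x] = f.[b * x, b].
Proof.
rewrite /dehom /= horner_comp hornerZ hornerX.
by have := horner_map (horner_eval b) f (b * x)%:P; rewrite /= /horner_eval hornerC.
Qed.

End Dehomogenization.

Lemma rmorph_det (S T : comNzRingType) (f : {rmorphism S -> T}) m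
    (A : 'M[S]_m) (B : 'M[T]_m) :
  (forall i j, f (A i j) = B i j) -> f (\det A) = \det B.
Proof.
by move=> fA; rewrite -det_map_mx; congr (\det _); apply/matrixP=> i j; rewrite mxE.
Qed.

Section Homogeneous.
Variables (R : realType) (n k : nat).
Local Notation C := R[i].
Local Notation mpol := ('I_k.+1 -> 'M[C]_n).
Implicit Types (B D : mpol) (p : C * C).

Lemma horner_pdet B l : (pdet B).[l] = \det (peval B l).
Proof.
rewrite -[LHS]/(horner_eval l (pdet B)); apply: rmorph_det => i j.
rewrite !summxE rmorph_sum; apply: eq_bigr => s _ /=.
by rewrite !mxE /horner_eval hornerM hornerXn hornerC.
Qed.

Lemma horner_hdet B p : (hdet B).[p.1, p.2] = \det (heval B p).
Proof.
case: p => a b /=; rewrite -[LHS]/((horner_eval b \o horner_eval a%:P) (hdet B)).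
apply: rmorph_det => i j.
rewrite !summxE rmorph_sum; apply: eq_bigr => s _ /=.
rewrite !mxE /horner_eval !hornerM hornerXn -!rmorphXn /= !hornerC.
by rewrite hornerXn.
Qed.

Lemma dehom_hdet B b : dehom b (hdet B) = (b ^+ k) ^+ n *: pdet B.
Proof.
rewrite -mul_polyC polyC_exp /pdet -detZ.
apply: (@rmorph_det {poly {poly C}} {poly C} (dehom b)) => i j.
rewrite !mxE !summxE rmorph_sum mulr_sumr; apply: eq_bigr => s _.
rewrite !mxE !rmorphM !rmorphXn /= dehomX !dehomC !hornerC hornerX.
rewrite exprZn -mul_polyC mulrA; congr (_ * _).
by rewrite mulrAC -!rmorphXn -rmorphM /= -exprD subnKC // -ltnS.
Qed.

Lemma hdet_swap B : swapXY (hdet B) = hdet (mrev B).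
Proof.
apply: (@rmorph_det {poly {poly C}} {poly {poly C}} swapXY) => i j.
rewrite !summxE rmorph_sum (reindex_inj rev_ord_inj); apply: eq_bigr => s _.
rewrite !mxE !rmorphM !rmorphXn /= swapXY_X swapXY_Y.
have sk : (s <= k)%N by rewrite -ltnS.
by rewrite swapXY_polyC map_polyC /= subSS subKn // mulrC [in RHS]mulrC (mulrC 'X^s).
Qed.

(** The remaining ['X] is beta, so this restricts the determinant to alpha = l beta. If l is an
    eigenvalue the restriction vanishes identically, which lets the linear form be split off. *)
Lemma hdet_line B l : (hdet B).[l *: 'X] = 'X^k ^+ n * (\det (peval B l))%:P.
Proof.
rewrite -(det_map_mx polyC) -detZ.
rewrite -[LHS]/(horner_eval (l *: 'X) (hdet B)); apply: rmorph_det => i j.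
rewrite !mxE !summxE !rmorph_sum mulr_sumr; apply: eq_bigr => s _ /=.
rewrite !mxE /horner_eval !hornerM.
rewrite hornerXn -rmorphXn /= !hornerC exprZn -mul_polyC rmorphM /= -(mulrA _%:P).
have sk : (s <= k)%N by rewrite -ltnS.
by rewrite -exprD subnKC // mulrAC mulrC.
Qed.

Lemma simple_heig_swap B p :
  simple_heig B p -> simple_heig (mrev B) (p.2, p.1).
Proof.
case: p => a b [p0 [q hE q0]]; split.
  by apply: contra_neq p0 => -[-> ->].
(* The exchange of variables turns b X - a Y into the negative of a X - b Y, hence the sign. *)
exists (- swapXY q); last by rewrite !hornerN horner2_swapXY oppr_eq0.
rewrite -hdet_swap hE !expr1 rmorphM rmorphB !rmorphM /= swapXY_X swapXY_Y.
rewrite !swapXY_polyC !map_polyC /=; ring.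
Qed.

Lemma simple_heig_det B p : simple_heig B p -> \det (heval B p) = 0.
Proof.
case=> _ [q hE _]; rewrite -horner_hdet hE expr1 !hornerM hornerD hornerN.
rewrite !hornerM !hornerX !hornerC hornerD hornerN !hornerM !hornerC hornerX.
by rewrite [p.1 * p.2]mulrC subrr mul0r.
Qed.

(** [dehom b] turns the linear form into b^2 (X - a / b) and the determinant into b^(k n) times
    [pdet B]. So X - a / b splits off [pdet B], with a cofactor that at a / b is a nonzero multiple
    of q(a, b). *)
Lemma simple_heig_simple_eig B p : p.2 != 0 ->
  simple_heig B p -> simple_eig B (p.1 / p.2).
Proof.
case: p => a b /= b0 [_ [q hE q0]].
have := dehom_hdet B b; rewrite hE expr1 rmorphM rmorphB !rmorphM /=.
rewrite dehomX !dehomC !hornerC hornerX => /esym pE.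
have c0 : (b ^+ k) ^+ n != 0 by rewrite !expf_neq0.
pose c := ((b ^+ k) ^+ n)^-1 * b ^+ 2.
have {}pE : pdet B = (c *: dehom b q) * ('X - (a / b)%:P).
  apply: (scalerI c0); rewrite pE /c -scalerAl scalerA mulrA divff // mul1r.
  have -> : a%:P = b%:P * (a / b)%:P by rewrite -rmorphM /= mulrC divfK.
  by rewrite -!mul_polyC rmorphXn /=; ring.
rewrite /simple_eig pE mupMr; first by rewrite -['X - _]expr1 mup_XsubCX eqxx.
rewrite rootE hornerZ horner_dehom [b * _]mulrC divfK // mulf_neq0 //.
by rewrite mulf_neq0 ?invr_eq0 ?expf_neq0.
Qed.

(** The factor theorem, over polynomials in beta, splits off alpha - l beta. Setting beta = 1 shows
    that the cofactor at (l, 1) is the derivative of [pdet B] at [l]. *)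
Lemma simple_eig_simple_heig B l : simple_eig B l -> simple_heig B (l, 1).
Proof.
move=> /simple_eigP[/eqP rl dl]; split.
  by apply/eqP => -[_ /eqP]; rewrite oner_eq0.
have /factor_theorem[q hE] : root (hdet B) (l *: 'X).
  by rewrite rootE hdet_line -horner_pdet rl mulr0.
exists q; first by rewrite hE expr1 mulrC mul1r -mul_polyC rmorphM.
have := dehom_hdet B 1; rewrite !expr1n scale1r hE rmorphM rmorphB /=.
rewrite dehomX dehomC scale1r hornerZ hornerX mulr1 => pE.
move: dl; rewrite -pE derivM derivXsubC mulr1 hornerD hornerM hornerXsubC subrr.
by rewrite mulr0 add0r horner_dehom mul1r.
Qed.

End Homogeneous.

(** * Chordal distance *)

Section Chordal.
Variable R : realType.
Local Notation C := R[i].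
Implicit Types (p q : C * C) (l m : C).

(** The Euclidean norm of the representative (l, 1). *)
Definition hnorm l : R := Num.sqrt (1 + cmod l ^+ 2).

Lemma hnorm_sqr l : hnorm l ^+ 2 = 1 + cmod l ^+ 2.
Proof. by rewrite sqr_sqrtr // addr_ge0 // sqr_ge0. Qed.

Lemma hnorm_ge1 l : 1 <= hnorm l.
Proof. by rewrite -[leLHS]sqrtr1 ler_wsqrtr // lerDl sqr_ge0. Qed.

Lemma hnorm_gt0 l : 0 < hnorm l.
Proof. exact: lt_le_trans ltr01 (hnorm_ge1 l). Qed.

(** With u, v the two values and x, y the moduli, (u - v)(u + v) = (x - y)(x + y) and x + y <= u +
    v. *)
Lemma hnorm_dist l m : `|hnorm l - hnorm m| <= cmod (l - m).
Proof.
have le l' m' : hnorm l' - hnorm m' <= cmod (l' - m').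
  have [h|h] := leP (hnorm l') (hnorm m').
    by rewrite (le_trans _ (cmod_ge0 _)) // subr_le0.
  have := cmod_dist l' m'; rewrite ler_norml => /andP[_]; apply: le_trans.
  have := hnorm_sqr l'; have := hnorm_sqr m'.
  have := hnorm_ge1 l'; have := hnorm_ge1 m'.
  have := cmod_ge0 l'; have := cmod_ge0 m'.
  set u := hnorm l' in h *; set v := hnorm m' in h *.
  set x := cmod l'; set y := cmod m' => y0 x0 v1 u1 vE uE.
  have xu : x <= u by nra.
  have yv : y <= v by nra.
  have yx : y <= x by nra.
  rewrite -(@ler_pM2r _ (u + v)); last by lra.
  have -> : (u - v) * (u + v) = (x - y) * (x + y).
    by rewrite -!subr_sqr uE vE; ring.
  by rewrite ler_wpM2l ?subr_ge0 // lerD.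
by rewrite ler_norml le andbT lerNl opprB (cmodB l).
Qed.

Lemma enorm2_gt0 p : p != (0, 0) -> 0 < enorm2 p.
Proof.
case: p => a b p0; rewrite sqrtr_gt0 lt_def addr_ge0 ?sqr_ge0 // andbT.
apply: contra_neqN p0; rewrite /= paddr_eq0 ?sqr_ge0 // !sqrf_eq0 !cmod_eq0.
by move=> /andP[/eqP -> /eqP ->].
Qed.

Lemma lagrange_identity p q :
  cmod (q.1^* * p.1 + q.2^* * p.2) ^+ 2 + cmod (p.1 * q.2 - p.2 * q.1) ^+ 2
  = (cmod p.1 ^+ 2 + cmod p.2 ^+ 2) * (cmod q.1 ^+ 2 + cmod q.2 ^+ 2).
Proof.
apply: (@complexI R); rewrite rmorphM !rmorphD /= !cmod_sqr.
by rewrite rmorphB !rmorphD /= !rmorphM /= !conjCK; ring.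
Qed.

(** [lagrange_identity] rewrites 1 - cos^2 as the square of the normalised 2 by 2 determinant of the
    representatives. *)
Lemma chordalE p q : p != (0, 0) -> q != (0, 0) ->
  chordal p q = cmod (p.1 * q.2 - p.2 * q.1) / (enorm2 p * enorm2 q).
Proof.
move=> /enorm2_gt0 p0 /enorm2_gt0 q0; rewrite /chordal /angle.
set N := enorm2 p * enorm2 q; set X := cmod (_ + _); set D := cmod (_ - _).
have N0 : 0 < N by rewrite mulr_gt0.
have X0 : 0 <= X := cmod_ge0 _; have D0 : 0 <= D := cmod_ge0 _.
have NE : X ^+ 2 + D ^+ 2 = N ^+ 2.
  by rewrite /N exprMn !sqr_sqrtr ?addr_ge0 ?sqr_ge0 // lagrange_identity.
have XN : X <= N by nra.
rewrite sin_acos; last first.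
  rewrite ler_pdivrMr // mul1r XN andbT (le_trans _ (_ : 0 <= _)) ?lerN10 //.
  by rewrite divr_ge0 // ltW.
have -> : 1 - (X / N) ^+ 2 = (D / N) ^+ 2.
  by rewrite !expr_div_n -[D ^+ 2](addKr (X ^+ 2)) NE; field; rewrite gt_eqF.
by rewrite sqrtr_sqr ger0_norm // divr_ge0 // ltW.
Qed.

Lemma enorm2_ratio p : p.2 != 0 -> enorm2 p = cmod p.2 * hnorm (p.1 / p.2).
Proof.
move=> p2; rewrite /hnorm -[cmod p.2 in RHS](ger0_norm (cmod_ge0 _)) -sqrtr_sqr.
rewrite -sqrtrM ?sqr_ge0 // mulrDr mulr1 -exprMn -cmodM.
by rewrite [p.2 * _]mulrC divfK // addrC.
Qed.

Lemma neq00 p : p.2 != 0 -> p != (0, 0).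
Proof. by apply: contra_neq => ->. Qed.

Lemma chordal_ratio p q : p.2 != 0 -> q.2 != 0 ->
  chordal p q = cmod (q.1 / q.2 - p.1 / p.2)
    / (hnorm (p.1 / p.2) * hnorm (q.1 / q.2)).
Proof.
move=> p2 q2; rewrite chordalE ?neq00 // !enorm2_ratio //.
have -> : p.1 * q.2 - p.2 * q.1 = - (p.2 * q.2 * (q.1 / q.2 - p.1 / p.2)).
  by field; rewrite p2 q2.
rewrite cmodN !cmodM; field.
by rewrite !gt_eqF ?hnorm_gt0 ?cmod_gt0.
Qed.

Lemma chordal_swap p q : chordal (p.2, p.1) (q.2, q.1) = chordal p q.
Proof.
by rewrite /chordal /angle /enorm2 /= ![cmod _.2 ^+ 2 + _]addrC [_.2^* * _ + _]addrC.
Qed.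

(** The bound is the chordal distance from [p] to the line beta = 0, so a line strictly closer to
    [p] is a different one. *)
Lemma chordal_line_at_infinity p q : p.2 != 0 -> q != (0, 0) ->
  chordal p q < cmod p.2 / enorm2 p -> q.2 != 0.
Proof.
move=> p2 q0; apply: contraTneq => q2; rewrite (chordalE (neq00 p2) q0) q2 mulr0 add0r.
have q1 : q.1 != 0.
  by apply: contra_neq q0 => q1; rewrite (surjective_pairing q) q1 q2.
rewrite cmodN cmodM /enorm2 q2 cmod0 expr0n addr0 sqrtr_sqr ger0_norm ?cmod_ge0 //.
by rewrite invfM mulrACA divff ?mulr1 ?ltxx ?gt_eqF ?cmod_gt0.
Qed.

(** With h the distance of the ratios, y the [hnorm] at [p] and chi the chordal distance, h <= chi y
    (y + h). The first bound, chi y <= 1/2, absorbs the h on the right and leaves h <= 2 chi y^2. *)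
Lemma chordal_ratio_near p q (e : R) : p.2 != 0 -> q.2 != 0 ->
  2 * chordal p q * hnorm (p.1 / p.2) <= 1 ->
  2 * chordal p q * hnorm (p.1 / p.2) ^+ 2 < e ->
  cmod (q.1 / q.2 - p.1 / p.2) < e.
Proof.
move=> p2 q2; have := chordal_ratio p2 q2.
set l := q.1 / q.2; set m := p.1 / p.2 => chE.
have : cmod (l - m) = chordal p q * (hnorm m * hnorm l).
  by rewrite chE divfK // gt_eqF // mulr_gt0 ?hnorm_gt0.
have c0 : 0 <= chordal p q.
  by rewrite chE divr_ge0 ?cmod_ge0 // ltW // mulr_gt0 ?hnorm_gt0.
have : hnorm l <= hnorm m + cmod (l - m).
  by rewrite -lerBlDl (le_trans (ler_norm _)) // hnorm_dist.
have := hnorm_gt0 m; have := hnorm_gt0 l; have := cmod_ge0 (l - m).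
set h := cmod _; set x := hnorm l; set y := hnorm m => h0 x0 y0 xy hE c1 ce.
have hx : h <= chordal p q * y * (y + h).
  by rewrite hE -mulrA ler_wpM2l // -hE ler_wpM2l // ltW.
by have := ler_wpM2r h0 c1; nra.
Qed.

End Chordal.

(** * Branches of lines against branches of ratios *)

Section Branches.
Variables (R : realType) (n k : nat).
Local Notation C := R[i].
Local Notation mpol := ('I_k.+1 -> 'M[C]_n).
Implicit Types (B D : mpol) (p : C * C) (d e : R).

Lemma pert_le_min D d e : pert_le D (fun=> 1) (Num.min d e) ->
  pert_le D (fun=> 1) d /\ pert_le D (fun=> 1) e.
Proof.
by split; apply: pert_le_trans H => //; rewrite ge_min lexx ?orbT.
Qed.

Lemma heig_branch_ratio B p (L : mpol -> C * C) :
  p.2 != 0 -> heig_branch B p L ->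
  (exists2 d, 0 < d & forall D, pert_le D (fun=> 1) d -> (L D).2 != 0) /\
  eig_branch B (p.1 / p.2) (fun D => (L D).1 / (L D).2).
Proof.
move=> p2 [[d0 d0_gt0 simple] near].
have [|d1 d1_gt0 near1] := near (cmod p.2 / enorm2 p).
  by rewrite divr_gt0 ?cmod_gt0 ?enorm2_gt0 ?neq00.
have L2 D : pert_le D (fun=> 1) (Num.min d0 d1) -> (L D).2 != 0.
  move=> /pert_le_min[/simple[LD _] /near1].
  exact: chordal_line_at_infinity.
have m_gt0 : 0 < Num.min d0 d1 by rewrite lt_min d0_gt0.
split; first by exists (Num.min d0 d1).
split.
  exists (Num.min d0 d1) => // D Dd; apply: simple_heig_simple_eig (L2 D Dd) _.
  by case/pert_le_min: Dd => /simple.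
move=> e e0; set y := hnorm (p.1 / p.2).
have y0 : 0 < y := hnorm_gt0 _.
have [|d d_gt0 nearD] := near (Num.min (1 / (2 * y)) (e / (2 * y ^+ 2))).
  by rewrite lt_min !divr_gt0 ?mulr_gt0 ?exprn_gt0.
exists (Num.min (Num.min d0 d1) d); first by rewrite lt_min m_gt0.
move=> D /pert_le_min[/L2 LD /nearD]; rewrite lt_min => /andP[c1 ce].
apply: chordal_ratio_near => //; rewrite mulrAC mulrC.
  by rewrite -ler_pdivlMr ?mulr_gt0 // ltW.
by rewrite -ltr_pdivlMr ?mulr_gt0 ?exprn_gt0.
Qed.

(** Both factors [hnorm] are at least 1, so the chordal distance is at most the distance of the
    ratios. *)
Lemma eig_branch_line B p (L : mpol -> C) :
  p.2 != 0 -> eig_branch B (p.1 / p.2) L ->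
  heig_branch B p (fun D => (L D, 1)).
Proof.
move=> p2 [[d d0 simple] near]; split.
  by exists d => // D /simple; exact: simple_eig_simple_heig.
move=> e /near[d' d'0 near']; exists d' => // D /near'; apply: le_lt_trans.
rewrite chordal_ratio ?oner_eq0 //= divr1 ler_pdivrMr ?mulr_gt0 ?hnorm_gt0 //.
by rewrite ler_peMr ?cmod_ge0 // mulr_ege1 ?hnorm_ge1.
Qed.

End Branches.

(** * Speed of an eigenvalue *)

Section Limits.
Variable R : realType.
Local Open Scope classical_set_scope.

(** The index set [P] does not depend on e, so uniform closeness of the functions to c s transfers
    to their suprema. *)
Lemma cvg_ereal_sup (T : Type) (P : set T) (s : T -> R) (c : R)
    (r : R -> T -> R) (A : R -> set (\bar R)) :
  P !=set0 -> 0 <= c -> has_ubound (s @` P) ->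
  (forall eta, 0 < eta -> \forall e \near (0 : R)^'+,
     A e = [set (r e x)%:E | x in P] /\
     forall x, P x -> `|r e x - c * s x| <= eta) ->
  ereal_sup (A e) @[e --> (0 : R)^'+] --> (c * sup (s @` P))%:E.
Proof.
move=> [x0 Px0] c0 ubs near_r; set K := sup _.
have hs : has_sup (s @` P) by split=> //; exists (s x0), x0.
have main eta : 0 < eta -> \forall e \near (0 : R)^'+,
    ((c * K - eta)%:E <= ereal_sup (A e) <= (c * K + eta)%:E)%E.
  move=> eta0.
  have eta2 : 0 < eta / 2 by rewrite divr_gt0.
  have etac : 0 < eta / (2 * (c + 1)) by rewrite divr_gt0 // mulr_gt0 // ltr_wpDl.
  apply: filterS (near_r _ eta2) => e [-> rP]; apply/andP; split.
    have [_ [x Px <-] Kx] := sup_adherent etac hs.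
    apply: le_ereal_sup_tmp; exists (r e x)%:E; first by exists x.
    rewrite lee_fin; have := rP _ Px; rewrite ler_norml => /andP[+ _].
    have cs : c * (K - eta / (2 * (c + 1))) <= c * s x by rewrite ler_wpM2l // ltW.
    have : c * (eta / (2 * (c + 1))) <= eta / 2.
      have := divfK (lt0r_neq0 (_ : 0 < 2 * (c + 1))) eta.
      rewrite mulr_gt0 ?ltr_wpDl // => /(_ isT).
      by move: etac; set u := eta / (2 * (c + 1)) => ? ?; lra.
    by move: cs; lra.
  apply: ge_ereal_sup => _ [x Px <-]; rewrite lee_fin.
  have := rP _ Px; rewrite ler_norml => /andP[_].
  have : c * s x <= c * K by rewrite ler_wpM2l // ub_le_sup //; exists x.
  by lra.
apply/fine_cvgP; split.
  apply: filterS (main 1 ltr01) => e /andP[lo hi].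
  by rewrite fin_numElt (lt_le_trans _ lo) ?ltNyr //= (le_lt_trans hi) ?ltry.
apply/cvgrPdist_le => eta eta0; apply: filterS (main eta eta0) => e /=.
case: (ereal_sup _) => [y| |] /=; rewrite ?leye_eq ?leeNy_eq //= ?andbF //.
by rewrite !lee_fin ler_norml => /andP[]; lra.
Qed.

End Limits.

Section Speed.
Local Open Scope classical_set_scope.
Variables (R : realType) (n k : nat).
Local Notation C := R[i].
Local Notation mpol := ('I_k.+1 -> 'M[C]_n).
Implicit Types (B D : mpol) (w : 'I_k.+1 -> R) (l : C) (p : C * C) (d e : R).

(* s D is the modulus of the derivative at B, in the direction D, of the *)
(* eigenvalue l.                                                         *)
Definition eig_speed B l (s : mpol -> R) : Prop :=
  (forall r D, 0 <= r -> s (mscale r D) = r * s D) /\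
  exists2 M, 0 <= M &
    (forall D, pert_le D (fun=> 1) 1 -> s D <= M) /\
    forall L, eig_branch B l L -> exists2 d0, 0 < d0 &
      forall D d, pert_le D (fun=> 1) d -> d <= d0 ->
        `|cmod (L D - l) - s D| <= M * d ^+ 2 /\ cmod (L D - l) <= M * d.

(** At a root l + h the expansion reads |tau(D) + g h| <= M (d + |h|)^2. Smallness of h, known from
    the branch, absorbs the h^2 part and gives |h| <= Q d; fed back, this makes the right-hand side
    O(d^2). The speed is |tau(D)| / |g|. *)
Lemma eig_speed_exists B l : simple_eig B l -> exists s, eig_speed B l s.
Proof.
move=> /simple_eigP[/eqP rBl derBl].
have [[t [M [M0 tZ tM pM]]] _ _] := smooth_pdet l B.
move: pM; rewrite !madd0 rBl; set g := (pdet B)^`().[l] => pM.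
have g0 : 0 < cmod g by rewrite cmod_gt0.
(* From a |g| <= M d + 2 M d^2 + 2 M a^2 with d <= 1 and 4 M a <= |g|, one gets a |g| <= 3 M d + a
   |g| / 2. *)
pose Q := 6 * M / cmod g.
have Q0 : 0 <= Q by rewrite divr_ge0 ?mulr_ge0 // ltW.
exists (fun D => cmod (t D) / cmod g); split.
  by move=> r D r0; rewrite tZ cmodM cmod_real ger0_norm // mulrA.
pose N := M * (1 + Q) ^+ 2 / cmod g.
have N0 : 0 <= N by rewrite divr_ge0 ?(ltW g0) ?(mulr_ge0 M0 (sqr_ge0 _)).
have Mg0 : 0 <= M / cmod g by rewrite divr_ge0 // ltW.
exists (N + Q + M / cmod g); first by rewrite addr_ge0 ?addr_ge0.
split.
  move=> D D1; apply: (@le_trans _ _ (M / cmod g)); last by rewrite lerDr addr_ge0.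
  by rewrite ler_wpM2r ?invr_ge0 ?cmod_ge0 // -[M]mulr1 tM.
move=> L [[d1 d1_gt0 simple] near].
have [|d2 d2_gt0 small] := near (Num.min 1 (cmod g / (4 * (M + 1)))).
  by rewrite lt_min ltr01 divr_gt0 ?mulr_gt0 ?ltr_wpDl.
exists (Num.min 1 (Num.min d1 d2)); first by rewrite !lt_min ltr01 d1_gt0.
move=> D d Dd; rewrite !le_min => /and3P[d1' dd1 dd2].
have d0 := pert_le_ge0 Dd.
have /simple/simple_eigP[/eqP rD _] := pert_le_trans (fun=> ler01) dd1 Dd.
have := small _ (pert_le_trans (fun=> ler01) dd2 Dd).
have := pM D d (L D - l) Dd d1'; rewrite (addrC l) subrK rD sub0r add0r cmodN.
have := tM D d Dd d1'.
set h := L D - l; set a := cmod h => tD + ha.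
have a0 : 0 <= a := cmod_ge0 _.
move: ha; rewrite lt_min => /andP[a1]; rewrite ltr_pdivlMr ?mulr_gt0 ?ltr_wpDl // => aM.
move=> /(_ (ltW a1)) rem.
have dist : `|a * cmod g - cmod (t D)| <= M * (d + a) ^+ 2.
  rewrite -cmodM -(cmodN (t D)); apply: le_trans (cmod_dist _ _) _.
  by rewrite opprK addrC.
have aQ : a <= Q * d.
  rewrite /Q mulrAC ler_pdivlMr //.
  move: dist; rewrite ler_norml => /andP[_ dist].
  have aa : 4 * M * a ^+ 2 <= a * cmod g.
    have := ler_wpM2l a0 (ltW aM); have := sqr_ge0 a; rewrite expr2; nra.
  have dd : M * d ^+ 2 <= M * d by rewrite ler_wpM2l // expr2 ler_piMr.
  have ad : 0 <= M * (d - a) ^+ 2 by rewrite mulr_ge0 ?sqr_ge0.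
  by move: dist aa dd ad tD; rewrite !expr2; lra.
have dN : `|a - cmod (t D) / cmod g| <= N * d ^+ 2.
  have -> : a - cmod (t D) / cmod g = (a * cmod g - cmod (t D)) / cmod g.
    by field; rewrite gt_eqF.
  rewrite normrM normfV (gtr0_norm g0) ler_pdivrMr //.
  rewrite /N mulrAC divfK ?gt_eqF // (le_trans dist) // -mulrA ler_wpM2l //.
  by rewrite -exprMn ler_pXn2r ?nnegrE ?addr_ge0 ?mulr_ge0 ?addr_ge0 //; lra.
split.
  by rewrite (le_trans dN) // ler_wpM2r ?sqr_ge0 // -addrA lerDl addr_ge0.
by rewrite (le_trans aQ) // ler_wpM2r // addrAC lerDr addr_ge0.
Qed.

Lemma eig_branch_rate B l s w (L : mpol -> C) : (forall i, 0 <= w i) ->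
  eig_speed B l s -> eig_branch B l L ->
  exists2 M, 0 <= M & forall eta, 0 < eta -> \forall e \near (0 : R)^'+,
    [/\ 0 < e, forall D, pert_le D w e -> simple_eig (madd B D) (L D) &
     forall D, pert_le D w 1 ->
       [/\ `|cmod (L (mscale e D) - l) / e - s D| <= eta,
        cmod (L (mscale e D) - l) <= eta &
        cmod (L (mscale e D) - l) / e <= M]].
Proof.
move=> w0 [sZ [M M0 [_ LP]]] LB; have [d0 d0_gt0 {}LP] := LP _ LB.
have [[d1 d1_gt0 simple] _] := LB.
pose W := 1 + \sum_i w i.
have W0 : 0 < W by rewrite ltr_wpDr // sumr_ge0.
exists (M * W); first by rewrite mulr_ge0 // ltW.
move=> eta eta0.
pose e0 := Num.min (Num.min d0 d1 / W)
                   (Num.min (eta / (M * W ^+ 2 + 1)) (eta / (M * W + 1))).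
have MW1 : 0 < M * W ^+ 2 + 1 by rewrite ltr_wpDl // mulr_ge0 ?sqr_ge0.
have MW2 : 0 < M * W + 1 by rewrite ltr_wpDl // mulr_ge0 // ltW.
have e0_gt0 : 0 < e0.
  by rewrite !lt_min !divr_gt0 // lt_min d0_gt0.
near=> e.
have e_gt0 : 0 < e by near: e; exact: nbhs_right_gt.
have : e <= e0 by near: e; exact: nbhs_right_le.
rewrite !le_min !ler_pdivlMr // le_min => /and3P[/andP[ed0 ed1] eM1 eM2].
have pertW D : pert_le D w e -> pert_le D (fun=> 1) (e * W).
  by apply: pert_le_sum => //; exact: ltW.
split=> // [D /pertW De|D D1].
  by apply: simple; exact: pert_le_trans De.
have /pertW De : pert_le (mscale e D) w e.
  by rewrite -[e in pert_le _ _ e]mulr1; apply: pert_leZ => //; exact: ltW.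
have [] := LP _ _ De ed0; rewrite (sZ _ _ (ltW e_gt0)).
set a := cmod _ => sM aM.
have a0 : 0 <= a := cmod_ge0 _.
split.
- have -> : a / e - s D = (a - e * s D) / e by field; rewrite gt_eqF.
  rewrite normrM normfV (gtr0_norm e_gt0) ler_pdivrMr // (le_trans sM) //.
  by nra.
- by rewrite (le_trans aM) //; nra.
- by rewrite ler_pdivrMr // (le_trans aM) //; nra.
Unshelve. all: by end_near. Qed.

End Speed.

(** * Condition numbers *)

Section ConditionNumbers.
Variables (R : realType) (n k : nat).
Local Notation C := R[i].
Local Notation mpol := ('I_k.+1 -> 'M[C]_n).
Implicit Types (B D : mpol) (w : 'I_k.+1 -> R) (l : C) (p : C * C) (d e : R).
Local Open Scope classical_set_scope.

Lemma near_pert_le w (Q : mpol -> Prop) : (forall i, 0 <= w i) ->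
  (exists2 d, 0 < d & forall D, pert_le D (fun=> 1) d -> Q D) ->
  \forall e \near (0 : R)^'+, forall D, pert_le D w e -> Q D.
Proof.
move=> w0 [d d0 dQ].
have W0 : 0 < 1 + \sum_i w i by rewrite ltr_wpDr // sumr_ge0.
near=> e => D De; apply: dQ.
have e0 : 0 < e by near: e; exact: nbhs_right_gt.
apply: pert_le_trans (pert_le_sum w0 (ltW e0) De) => //.
rewrite -ler_pdivlMr //; near: e; apply: nbhs_right_le.
by rewrite divr_gt0.
Unshelve. all: by end_near. Qed.

(** Rescaling moves the dependence on e from the index set to the function, the form that
    [cvg_ereal_sup] takes. *)
Lemma pert_le_image w e (T : Type) (f : mpol -> T) : 0 < e ->
  [set f D | D in [set D | pert_le D w e]] =
  [set f (mscale e D) | D in [set D | pert_le D w 1]].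
Proof.
move=> e0; apply/seteqP; split=> _ [D /= De <-].
  exists (mscale e^-1 D); last by rewrite mscaleA divff ?gt_eqF // mscale1.
  by rewrite /= -(mulVf (lt0r_neq0 e0)); apply: pert_leZ => //; rewrite invr_ge0 ltW.
exists (mscale e D) => //=.
by rewrite -[e in pert_le _ _ e]mulr1; apply: pert_leZ => //; exact: ltW.
Qed.

(** Take for [dx] a nonzero kernel vector minus [x]. This supplies the eigenvector demanded in the
    shift sets; the transposes appear because [det0P] speaks of row vectors. *)
Lemma kernel_shift (M : 'M[C]_n) (x : 'cV[C]_n) : \det M = 0 ->
  exists dx, x + dx != 0 /\ M *m (x + dx) = 0.
Proof.
move=> M0; have /det0P[v v0 vM] : \det M^T == 0 by rewrite det_tr M0.
exists (v^T - x); rewrite addrC subrK; split.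
  by apply: contra_neq v0 => v0; rewrite -[v]trmxK v0 trmx0.
by rewrite -[M]trmxK -trmx_mul vM trmx0.
Qed.

Lemma peval_madd B D l : peval (madd B D) l = peval B l + peval D l.
Proof. by rewrite /peval -big_split; apply: eq_bigr => i _; rewrite scalerDr. Qed.

Lemma eig_shiftsE B w l x (L : mpol -> C) e (T : Type) (f : C -> T) : 0 < e ->
  (forall D, pert_le D w e -> simple_eig (madd B D) (L D)) ->
  [set f dl | dl in eig_shifts B w l x L e] =
  [set f (L (mscale e D) - l) | D in [set D | pert_le D w 1]].
Proof.
move=> e0 simple; rewrite -(pert_le_image w (fun D => f (L D - l)) e0).
apply/seteqP; split=> [_ [dl [D [dx [De lE _ _]]] <-]|_ [D /= De <-]].
  by exists D => //=; rewrite -lE addrC addKr.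
have [/eqP rD _] := (simple_eigP _ _).1 (simple D De).
have [dx [x0 xk]] : exists dx, x + dx != 0 /\ peval (madd B D) (L D) *m (x + dx) = 0.
  by apply: kernel_shift; rewrite -horner_pdet.
have LE : l + (L D - l) = L D by rewrite addrC subrK.
exists (L D - l) => //; exists D, dx; rewrite LE; split=> //.
by rewrite -peval_madd.
Qed.

Lemma heig_shiftsE B w p x (L : mpol -> C * C) e (T : Type) (f : C * C -> T) :
  0 < e ->
  (forall D, pert_le D w e -> simple_heig (madd B D) (L D)) ->
  [set f dp | dp in heig_shifts B w p x L e] =
  [set f (L (mscale e D) - p) | D in [set D | pert_le D w 1]].
Proof.
move=> e0 simple; rewrite -(pert_le_image w (fun D => f (L D - p)) e0).
apply/seteqP; split=> [_ [dp [D [dx [De pE _ _]]] <-]|_ [D /= De <-]].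
  by exists D => //=; rewrite -pE addrC addKr.
have [dx [x0 xk]] := kernel_shift x (simple_heig_det (simple D De)).
have LE : p + (L D - p) = L D by rewrite addrC subrK.
by exists (L D - p) => //; exists D, dx; rewrite LE.
Qed.

Definition max_speed (s : mpol -> R) w : R := sup (s @` [set D | pert_le D w 1]).

Lemma pert_le_neq0 w : (forall i, 0 <= w i) -> [set D : mpol | pert_le D w 1] !=set0.
Proof. by move=> w0; exists (fun=> 0); exact: pert_le0. Qed.

Lemma eig_speed_ubound B l s w : (forall i, 0 <= w i) -> eig_speed B l s ->
  has_ubound (s @` [set D | pert_le D w 1]).
Proof.
move=> w0 [sZ [M M0 [sM _]]]; have W0 : 0 < 1 + \sum_i w i.
  by rewrite ltr_wpDr // sumr_ge0.
exists ((1 + \sum_i w i) * M) => _ [D /= D1 <-].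
have := pert_le_sum w0 ler01 D1; rewrite mul1r.
set W := 1 + _ in W0 * => DW.
have -> : D = mscale W (mscale W^-1 D).
  by rewrite mscaleA divff ?gt_eqF // mscale1.
rewrite (sZ _ _ (ltW W0)) ler_pM2l //; apply: sM.
have W1 : 0 <= W^-1 by rewrite invr_ge0 ltW.
by have := pert_leZ W1 DW; rewrite mulVf ?gt_eqF.
Qed.

(** The factor [c] serves two condition numbers at once: c = 1 for kappa_a and c = |l| for
    kappa_r. *)
Lemma cvg_sup_eig_shifts B w l (x : 'cV[C]_n) (L : mpol -> C) s (c : R) :
  (forall i, 0 <= w i) -> eig_speed B l s -> eig_branch B l L -> 0 < c ->
  ereal_sup [set (cmod dl / (e * c))%:E | dl in eig_shifts B w l x L e]
    @[e --> (0 : R)^'+] --> (c^-1 * max_speed s w)%:E.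
Proof.
move=> w0 sp LB c0; have [M M0 rate] := eig_branch_rate w0 sp LB.
apply: (@cvg_ereal_sup R _ _ s c^-1
  (fun e D => cmod (L (mscale e D) - l) / (e * c))).
- exact: pert_le_neq0.
- by rewrite invr_ge0 ltW.
- exact: eig_speed_ubound sp.
move=> eta eta0; apply: filterS (rate (eta * c) _); last by rewrite mulr_gt0.
move=> e [e0 simple near]; split.
  exact: (eig_shiftsE l x (fun dl => (cmod dl / (e * c))%:E)).
move=> D /near[sD _ _].
have -> : cmod (L (mscale e D) - l) / (e * c) - c^-1 * s D =
          (cmod (L (mscale e D) - l) / e - s D) / c.
  by field; rewrite !gt_eqF.
by rewrite normrM normfV (gtr0_norm c0) ler_pdivrMr.
Qed.

Lemma is_kappa_a_max_speed B w l s : (forall i, 0 <= w i) ->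
  simple_eig B l -> eig_speed B l s -> is_kappa_a B w l (max_speed s w).
Proof.
move=> w0 sl sp; split=> [|x L _ _ LB]; first exact: eig_branch_exists.
have := cvg_sup_eig_shifts x w0 sp LB ltr01; rewrite invr1 mul1r.
by under eq_fun do under eq_imagel do rewrite mulr1.
Qed.

Lemma is_kappa_r_max_speed B w l s : (forall i, 0 <= w i) -> l != 0 ->
  simple_eig B l -> eig_speed B l s ->
  is_kappa_r B w l ((cmod l)^-1 * max_speed s w).
Proof.
move=> w0 l0 sl sp; split=> [|x L _ _ LB]; first exact: eig_branch_exists.
by apply: cvg_sup_eig_shifts => //; rewrite cmod_gt0.
Qed.

(** The chordal distance is h / (u v), with h the displacement of the ratio and u, v the values of
    [hnorm] before and after. As v tends to u, the quotient by e tends to the speed divided by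
    u^2. *)
Lemma is_kappa_theta_max_speed B w p s : (forall i, 0 <= w i) -> p.2 != 0 ->
  simple_heig B p -> eig_speed B (p.1 / p.2) s ->
  is_kappa_theta B w p (1 / (1 + cmod (p.1 / p.2) ^+ 2) * max_speed s w).
Proof.
move=> w0 p2 simp sp; have sl := simple_heig_simple_eig p2 simp.
split=> [|x L _ _ LB].
  have [L /(eig_branch_line p2)] := eig_branch_exists sl.
  by exists (fun D => (L D, 1)).
have [L2 LB'] := heig_branch_ratio p2 LB.
have [M M0 rate] := eig_branch_rate w0 sp LB'.
have simple := near_pert_le w0 LB.1; have {}L2 := near_pert_le w0 L2.
have c0 : 0 <= 1 / (1 + cmod (p.1 / p.2) ^+ 2).
  by rewrite divr_ge0 // addr_ge0 // sqr_ge0.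
apply: (@cvg_ereal_sup R _ _ s _ (fun e D => chordal p (L (mscale e D)) / e)) => //.
- exact: pert_le_neq0.
- exact: eig_speed_ubound sp.
move=> eta eta0; have M1 : 0 < M + 1 by rewrite ltr_wpDl.
have eta1 : 0 < eta / (M + 1) by rewrite divr_gt0.
near=> e.
have e0 : 0 < e by near: e; exact: nbhs_right_gt.
have LeP D : pert_le D w e -> simple_heig (madd B D) (L D).
  by move: D; near: e.
have L2P D : pert_le D w e -> (L D).2 != 0 by move: D; near: e.
have [_ _ near] : [/\ 0 < e,
     forall D, pert_le D w e ->
       simple_eig (madd B D) ((L D).1 / (L D).2) &
     forall D, pert_le D w 1 ->
       [/\ `|cmod ((L (mscale e D)).1 / (L (mscale e D)).2 - p.1 / p.2) / e - s D|
            <= eta / (M + 1),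
        cmod ((L (mscale e D)).1 / (L (mscale e D)).2 - p.1 / p.2) <= eta / (M + 1) &
        cmod ((L (mscale e D)).1 / (L (mscale e D)).2 - p.1 / p.2) / e <= M]].
  by near: e; exact: rate.
split.
  rewrite (heig_shiftsE p x (fun dp => (chordal p (p + dp) / e)%:E)) //.
  by apply: eq_imagel => D _; rewrite (addrC p) subrK.
move=> D D1; have [sD hD aD] := near D D1.
have /L2P qD : pert_le (mscale e D) w e.
  by rewrite -[e in pert_le _ _ e]mulr1; apply: pert_leZ => //; exact: ltW.
rewrite chordal_ratio // -hnorm_sqr; move: sD hD aD.
set l := p.1 / p.2; set m := _.1 / _.2; set h := cmod (m - l).
set u := hnorm l; set v := hnorm m => sD hD aD.
have := hnorm_dist m l; rewrite -/u -/v -/h => uv.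
have u1 : 1 <= u := hnorm_ge1 l; have v1 : 1 <= v := hnorm_ge1 m.
have u0 := lt_le_trans ltr01 u1; have v0 := lt_le_trans ltr01 v1.
(* The first term pays for replacing v by u, the second for replacing h / e by the speed. They use M
   shares and one share of eta / (M + 1), since h / e <= M. *)
have -> : h / (u * v) / e - 1 / u ^+ 2 * s D =
    (h / e) * ((u - v) / (u ^+ 2 * v)) + (h / e - s D) / u ^+ 2.
  by field; rewrite !gt_eqF.
have he0 : 0 <= h / e by rewrite divr_ge0 ?cmod_ge0 // ltW.
rewrite (le_trans (ler_normD _ _)) // normrM (ger0_norm he0).
rewrite -[eta](divfK (lt0r_neq0 M1)) mulrDr mulr1 [_ * M]mulrC lerD //.
  have uv0 : 0 < u ^+ 2 * v by rewrite mulr_gt0 // exprn_gt0.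
  rewrite ler_pM // normrM normfV (gtr0_norm uv0) ler_pdivrMr // distrC.
  rewrite (le_trans uv) //.
  by rewrite (le_trans hD) // (ler_peMr (ltW eta1)) // mulr_ege1 // exprn_ege1.
rewrite normrM normfV (gtr0_norm (exprn_gt0 _ u0)) ler_pdivrMr ?exprn_gt0 //.
by rewrite (le_trans sD) // (ler_peMr (ltW eta1)) // exprn_ege1.
Unshelve. all: by end_near. Qed.

(** The limits are asserted for all eigenvectors and branches, so uniqueness needs one of each: a
    branch is part of the relation, and the vanishing determinant gives an eigenvector. *)
Lemma is_kappa_theta_unique B w p (K K' : R) : simple_heig B p ->
  is_kappa_theta B w p K -> is_kappa_theta B w p K' -> K = K'.
Proof.
move=> /simple_heig_det det0 [[L LB] KP] [_ K'P].
have [x [x0 xk]] := kernel_shift 0 det0; rewrite add0r in x0 xk.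
by apply: EFin_inj; apply: cvg_unique (KP x L x0 xk LB) (K'P x L x0 xk LB).
Qed.

(** * Exchange of alpha and beta *)

Section Reversal.

Let wrev w : 'I_k.+1 -> R := fun i => w (rev_ord i).
Let swap p : C * C := (p.2, p.1).
(** A perturbation [D] of the reversed polynomial is the reversal of the perturbation [mrev D] of
    the original one, hence the inner [mrev]. *)
Let Lrev (L : mpol -> C * C) : mpol -> C * C := fun D => swap (L (mrev D)).

Let swapK : involutive swap. Proof. by case. Qed.

Lemma mrevK : involutive (@mrev R n k).
Proof. by move=> B; apply/funext => i; rewrite /mrev rev_ordK. Qed.

Let wrevK : involutive wrev.
Proof. by move=> w; apply/funext => i; rewrite /wrev rev_ordK. Qed.

Let LrevK : involutive Lrev.
Proof. by move=> L; apply/funext => D; rewrite /Lrev swapK mrevK. Qed.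

Lemma pert_le_rev D w d : pert_le D w d -> pert_le (mrev D) (wrev w) d.
Proof. by move=> Dd i; exact: Dd. Qed.

Lemma heval_rev B p : heval (mrev B) (swap p) = heval B p.
Proof.
rewrite /heval (reindex_inj rev_ord_inj); apply: eq_bigr => i _ /=.
rewrite /mrev rev_ordK subSS subKn; last by rewrite -ltnS.
by rewrite mulrC.
Qed.

Lemma heig_branch_rev B p L :
  heig_branch B p L -> heig_branch (mrev B) (swap p) (Lrev L).
Proof.
move=> [[d d0 simple] near]; split.
  exists d => // D /(@pert_le_rev _ (fun=> 1))/simple/simple_heig_swap.
  have -> // : mrev (madd B (mrev D)) = madd (mrev B) D.
  by apply/funext => i; rewrite /mrev /madd rev_ordK.
move=> e /near[d' d'0 near']; exists d' => // D /(@pert_le_rev _ (fun=> 1))/near'.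
by rewrite chordal_swap.
Qed.

Lemma heig_shifts_rev B w p x L e dp :
  heig_shifts B w p x L e dp ->
  heig_shifts (mrev B) (wrev w) (swap p) x (Lrev L) e (swap dp).
Proof.
move=> [D [dx [De pE x0 xk]]]; exists (mrev D), dx; split=> //.
- exact: pert_le_rev.
- by rewrite /Lrev mrevK -pE.
- by rewrite -[madd _ _]/(mrev (madd B D)) -[_ + _]/(swap (p + dp)) heval_rev.
Qed.

(** The exchange preserves chordal distance and maps shifts to shifts. Being an involution, it gives
    both inclusions from [heig_shifts_rev], so the suprema agree for every e. *)
Lemma is_kappa_theta_rev B w p K :
  is_kappa_theta (mrev B) (wrev w) (swap p) K -> is_kappa_theta B w p K.
Proof.
case=> [[L LB] KP]; split.
  by exists (Lrev L); have := heig_branch_rev LB; rewrite mrevK swapK.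
move=> x {LB}L x0 xk LB.
have := KP x _ x0 _ (heig_branch_rev LB); rewrite heval_rev => /(_ xk).
apply: cvg_trans; apply: near_eq_cvg; apply: nearW => e; congr ereal_sup.
apply/seteqP; split=> _ [dp dpP <-].
  exists (swap dp); last by rewrite -(chordal_swap p).
  by have := heig_shifts_rev dpP; rewrite mrevK wrevK swapK LrevK.
exists (swap dp); first exact: heig_shifts_rev.
by rewrite -(chordal_swap p).
Qed.

End Reversal.

End ConditionNumbers.

Theorem theorem3p5 (R : realType) (n k : nat) (B : 'I_k.+1 -> 'M[R[i]]_n)
    (w : 'I_k.+1 -> R) (a0 b0 : R[i]) :
  (forall i, 0 <= w i) ->
  regular B ->
  (a0, b0) != (0, 0) ->
  simple_heig B (a0, b0) ->
  exists2 kt : R, is_kappa_theta B w (a0, b0) kt &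
  [/\ b0 != 0 ->
        exists2 ka : R, is_kappa_a B w (a0 / b0) ka &
          kt = ka * (1 / (1 + cmod (a0 / b0) ^+ 2)),
      a0 != 0 ->
        exists2 ka : R, is_kappa_a (mrev B) (fun i => w (rev_ord i)) (b0 / a0) ka &
          kt = ka * (1 / (1 + cmod (b0 / a0) ^+ 2))
    & a0 != 0 -> b0 != 0 ->
        exists2 kr : R, is_kappa_r B w (a0 / b0) kr &
          kt = kr * (cmod (a0 / b0) / (1 + cmod (a0 / b0) ^+ 2))].
Proof.
move=> w0 _ ab0 simp.
have simpr : simple_heig (mrev B) (b0, a0) := simple_heig_swap simp.
have w0r i : 0 <= w (rev_ord i) by [].
have direct : b0 != 0 -> exists s, [/\ simple_eig B (a0 / b0),
    eig_speed B (a0 / b0) s &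
    is_kappa_theta B w (a0, b0) (1 / (1 + cmod (a0 / b0) ^+ 2) * max_speed s w)].
  move=> b0'; have sl := simple_heig_simple_eig (p := (a0, b0)) b0' simp.
  have [s sp] := eig_speed_exists sl; exists s; split=> //.
  exact: (@is_kappa_theta_max_speed _ _ _ _ _ (a0, b0)).
have reverse : a0 != 0 -> exists2 ka,
    is_kappa_a (mrev B) (fun i => w (rev_ord i)) (b0 / a0) ka &
    is_kappa_theta B w (a0, b0) (ka * (1 / (1 + cmod (b0 / a0) ^+ 2))).
  move=> a0'; have sl := simple_heig_simple_eig (p := (b0, a0)) a0' simpr.
  have [s sp] := eig_speed_exists sl.
  exists (max_speed s (fun i => w (rev_ord i))).
    exact: is_kappa_a_max_speed.
  apply: is_kappa_theta_rev; rewrite mulrC.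
  exact: (@is_kappa_theta_max_speed _ _ _ _ _ (b0, a0)).
(* One of the two charts contains the eigenvalue, which yields a value; uniqueness then identifies
   it with the value computed in either chart. *)
have [kt ktP] : exists kt, is_kappa_theta B w (a0, b0) kt.
  have [b00|/direct[s [_ _ ?]]] := eqVneq b0 0; last by eexists; eassumption.
  have /reverse[ka _ ?] : a0 != 0 by apply: contra_neq ab0 => ->; rewrite b00.
  by eexists; eassumption.
have kt_unique K := @is_kappa_theta_unique _ _ _ B w _ kt K simp ktP.
exists kt => //; split.
- move=> /direct[s [sl sp /kt_unique ->]].
  by exists (max_speed s w); [exact: is_kappa_a_max_speed|rewrite mulrC].
- by move=> /reverse[ka kaP /kt_unique ->]; exists ka.
- move=> a0' b0'; have [s [sl sp /kt_unique ->]] := direct b0'.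
  have l0 : a0 / b0 != 0 by rewrite mulf_neq0 ?invr_eq0.
  exists ((cmod (a0 / b0))^-1 * max_speed s w); first exact: is_kappa_r_max_speed.
  rewrite -hnorm_sqr; move: l0; rewrite -cmod_eq0 => l0; field.
  by rewrite l0 gt_eqF ?hnorm_gt0.
Qed.
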